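(* Let $(H,X)$ be an admissible pair and let $\varphi$ be a nonzero vector in $H$. The following are equivalent: (c) $\varphi$ is a Hilbert point in $X$. (d) $\varphi$ is in $X^\ast$ and $\|\varphi\|_X \|\varphi\|_{X^\ast} = \|\varphi\|_H^2$.
   Context: All spaces are over the complex numbers, and $\langle\cdot,\cdot\rangle$ is the inner product of $H$, linear in the first argument. An admissible pair $(H,X)$ is a Hilbert space $H$ that can be embedded as a dense subspace of a Banach space $X$ such that the norm of the embedding is $1$; $H$ is identified with its image in $X$, so $\|f\|_X \leq \|f\|_H$ for every $f$ in $H$. A nonzero vector $\varphi$ in $H$ is called a Hilbert point in $X$ if $\|\varphi+f\|_X \geq \|\varphi\|_X$ holds whenever $f$ is in $H$ and $\langle f,\varphi\rangle = 0$. $X^\ast$ denotes the dual space of $X$. Every $\Psi$ in $X^\ast$ restricts to a bounded linear functional on $H$, so by the Riesz representation theorem there is a unique $\psi$ in $H$ such that $\Psi(f) = \langle f,\psi\rangle$ for every $f$ in $H$. This embeds $X^\ast$ as a subspace of $H$ (antilinearly). A vector $\psi$ in $H$ is said to be in $X^\ast$ if it belongs to this subspace, i.e. if $f \mapsto \langle f,\psi\rangle$, $f \in H$, extends to a bounded linear functional $\Psi$ on $X$; in that case $\|\psi\|_{X^\ast}$ denotes $\|\Psi\|_{X^\ast}$. *)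

(* Defs.v *)
From mathcomp Require Import all_boot all_order all_algebra sesquilinear.
From mathcomp Require Import complex.
From mathcomp Require Import boolp classical_sets reals topology normedtype.
Import Order.TTheory GRing.Theory Num.Theory.
Import numFieldNormedType.Exports.

Set Implicit Arguments.
Unset Strict Implicit.
Unset Printing Implicit Defensive.

Local Open Scope classical_set_scope.
Local Open Scope ring_scope.
Local Open Scope complex_scope.

(* [inner] is linear in its first argument and antilinear in its second. *)
Record hilbertSpace (R : realType) := HilbertSpace {
  hilbert_sort :> completeNormedModType R[i];
  inner : {dot hilbert_sort for Num.conj};
  inner_norm : forall f : hilbert_sort, inner f f = `|f| ^+ 2 }.

(* Norms of a normedModType R[i] are R[i]-valued, with zero imaginary part.   *)
(* The value is meaningful for bounded [T] only: [sup] of an unbounded set is *)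
(* 0 by convention.                                                           *)
Definition opnorm (R : realType) (V W : normedModType R[i]) (T : V -> W) : R :=
  sup [set complex.Re `|T x| | x in [set x : V | `|x| <= 1]].

(* [H] is identified with its image under [iota]. *)
Record admissible_pair (R : realType) (H : hilbertSpace R)
    (X : completeNormedModType R[i]) (iota : {linear H -> X}) : Prop := {
  admissible_inj : injective iota;
  admissible_dense : dense (range iota);
  admissible_bounded : bounded_near iota (nbhs (0 : H));
  admissible_norm : opnorm iota = 1 }.

Section HilbertPoints.
Variables (R : realType) (H : hilbertSpace R) (X : completeNormedModType R[i]).
Variable iota : {linear H -> X}.

Definition hilbert_point (phi : H) : Prop :=
  phi != 0 /\
  forall f : H, inner H f phi = 0 -> `|iota phi| <= `|iota (phi + f)|.

Definition dual_extension (psi : H) : set {linear X -> R[i]^o} :=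
  [set Psi : {linear X -> R[i]^o} |
    bounded_near Psi (nbhs (0 : X)) /\
    forall f : H, Psi (iota f) = inner H f psi].

Definition in_dual (psi : H) : Prop := dual_extension psi !=set0.

(* When [iota] has dense range, [dual_extension psi] has at most one element, *)
(* so that this is the norm of the extension of [psi]; it is a dummy value    *)
(* if [~ in_dual psi].                                                        *)
Definition dual_norm (psi : H) : R :=
  xget 0 [set opnorm Psi | Psi in dual_extension psi].

End HilbertPoints.

(* Main.v *)
Require Import Defs.
From HB Require Import structures.
From mathcomp Require Import all_boot all_order all_algebra sesquilinear.
From mathcomp Require Import complex.
From mathcomp Require Import boolp classical_sets reals topology normedtype.
Import Order.TTheory GRing.Theory Num.Theory.
Import numFieldNormedType.Exports.

Set Implicit Arguments.
Unset Strict Implicit.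

Local Open Scope classical_set_scope.
Local Open Scope ring_scope.
Local Open Scope complex_scope.

(** Both conditions say that the functional [f |-> <f, phi>] on [H] is bounded
for the norm of [X], with the constant [C = |phi|_H ^ 2 / |phi|_X] (the smallest
possible one, since [f = phi] attains equality).

If [phi] is a Hilbert point, any [f] with [<f, phi> <> 0] can be rescaled to
[phi + g] with [g] orthogonal to [phi]; the minimality of [|phi|_X] among such
vectors then reads [|<f, phi>| <= C |f|_X] ([hilbert_point_bound]). As [H] is
dense in [X], the functional extends to [X] ([extend_functional]) and any
bounded extension keeps the constant [C] ([bounded_on_dense_range]), so the dual
norm is at most [C]; evaluation at [phi] shows that it is at least [C].

Conversely, if an extension has norm [C] and [g] is orthogonal to [phi], then
[|phi|_H ^ 2 = <phi + g, phi> <= C |phi + g|_X], which is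
[|phi|_X <= |phi + g|_X].

The extension by density rests on the order completeness of the reals: the value at [x] is to be a complex number [w] within
[K |x - f|_X] of [<f, phi>] for all [f] in [H] at once. Such a [w] exists
for [K = 2 C] by taking suprema of the real and imaginary parts
([complex_sandwich]). It is unique by density, and this forces linearity.
The factor [2] is harmless because the sharp constant is recovered
afterwards from the values on [H]. *)

Lemma le_Re (R : realType) (x y : R[i]) :
  x <= y -> complex.Re x <= complex.Re y.
Proof. by rewrite lecE => /andP[]. Qed.

Lemma Re_norm (R : realType) (V : normedModType R[i]) (x : V) :
  (complex.Re `|x|)%:C = `|x|.
Proof. by rewrite RRe_real ?normr_real. Qed.

Lemma normc_le_ReIm (R : realType) (z : R[i]) (c : R) :
  `|complex.Re z| <= c -> `|complex.Im z| <= c -> `|z| <= (c *+ 2)%:C.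
Proof.
move=> Rec Imc; rewrite [z]complexE.
rewrite (le_trans (ler_normD _ _))// normrM complexiE normCi mul1r.
by rewrite mulr2n rmorphD/= !normc_def/= !expr0n/= !addr0 !sqrtr_sqr lerD ?lecR.
Qed.

(** Closed intervals of the line that meet pairwise have a common point: the
supremum of their left ends. *)
Lemma real_sandwich (R : realType) (I : Type) (i0 : I) (u d : I -> R) :
  (forall i j, u i - u j <= d i + d j) ->
  exists r, forall i, `|r - u i| <= d i.
Proof.
move=> ud; set A := [set u i - d i | i in [set: I]].
have ubA i : ubound A (u i + d i).
  by move=> _ [j _ <-]; rewrite lerBlDr -addrA -lerBlDl [d i + _]addrC ud.
have A0 : A !=set0 by exists (u i0 - d i0), i0.
exists (sup A) => i; rewrite ler_distl ge_sup// andbT.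
by apply: ub_le_sup; [exists (u i + d i) | exists i].
Qed.

(** Discs that meet pairwise need not have a common point, but their bounding
squares do, and a square lies in the concentric disc of twice the radius. *)
Lemma complex_sandwich (R : realType) (I : Type) (i0 : I) (z : I -> R[i])
    (d : I -> R) :
  (forall i j, `|z i - z j| <= (d i + d j)%:C) ->
  exists w, forall i, `|w - z i| <= (d i *+ 2)%:C.
Proof.
move=> zd.
have Rezd i j : complex.Re (z i) - complex.Re (z j) <= d i + d j.
  rewrite -lecR (le_trans _ (zd i j))// (le_trans _ (normc_ge_Re _))//.
  by rewrite lecR raddfB ler_norm.
have Imzd i j : complex.Im (z i) - complex.Im (z j) <= d i + d j.
  (* Multiplying by the imaginary unit reduces this to the previous case. *)
  rewrite -lecR (le_trans _ (zd i j))// -[`|_|]mulr1 -normCi -complexiE -normrM.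
  rewrite (le_trans _ (normc_ge_Re _))// lecR ReiNIm normrN raddfB ler_norm//.
have [r Hr] := @real_sandwich _ _ i0 _ _ Rezd.
have [s Hs] := @real_sandwich _ _ i0 _ _ Imzd.
exists (r +i* s) => i; apply: normc_le_ReIm; rewrite raddfB /=; [exact: Hr|exact: Hs].
Qed.

Section DenseRange.
Variables (R : realType) (V : lmodType R[i]) (X : normedModType R[i]).
Variable iota : {linear V -> X}.
Hypothesis iota_dense : dense (range iota).

Lemma dense_range_norm (x : X) (e : R[i]) :
  0 < e -> exists f, `|x - iota f| < e.
Proof.
move=> e0; have [||y [xy [f _ fy]]] := @iota_dense (ball x e).
- by exists x; exact: ballxx.
- exact: ball_open.
by exists f; rewrite fy; move: xy; rewrite -ball_normE.
Qed.

(** With [M] any bound of [T], moving [x] to a point [iota f] at distance [e]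
costs at most [(M + C) e]. *)
Lemma bounded_on_dense_range (T : {linear X -> R[i]^o}) (C : R[i]) :
  0 <= C -> bounded_near T (nbhs (0 : X)) ->
  (forall f, `|T (iota f)| <= C * `|iota f|) -> forall x, `|T x| <= C * `|x|.
Proof.
move=> C0 /linear_boundedP/pinfty_ex_gt0[M M0 TM] TC x.
apply/ler_addgt0Pr => e e0.
have MC0 : 0 < M + C by rewrite ltr_pwDl.
have [f fx] := @dense_range_norm x (e / (M + C)) (divr_gt0 e0 MC0).
have fxE : (M + C) * `|x - iota f| <= e.
  by rewrite mulrC -ler_pdivlMr// ltW.
rewrite -(subrK (iota f) x) linearD (le_trans (ler_normD _ _))//.
rewrite subrK (le_trans (lerD (TM _) (TC _)))//.
rewrite (le_trans _ (lerD (lexx _) fxE))// mulrDl [leRHS]addrCA lerD2l -mulrDr.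
rewrite ler_wpM2l// -{1}(subKr x (iota f)) (le_trans (ler_normB _ _))//.
Qed.

(** The value at [x] is any number within [2 C |x - iota f|] of [h f] for every
[f]. The defect of linearity of such a choice is compared with the vanishing
defect of [h] at nearby points [iota f], [iota g], hence is arbitrarily small. *)
Lemma extend_functional (h : {linear V -> R[i]^o}) (C : R[i]) :
  0 <= C -> (forall f, `|h f| <= C * `|iota f|) ->
  exists Psi : {linear X -> R[i]^o},
    bounded_near Psi (nbhs (0 : X)) /\ forall f, Psi (iota f) = h f.
Proof.
move=> C0 hC.
have near_h x : exists w : R[i], forall f, `|w - h f| <= C *+ 2 * `|x - iota f|.
  pose d f := complex.Re (C * `|x - iota f|).
  have dE f : (d f)%:C = C * `|x - iota f|.
    by rewrite RRe_real// rpredM ?normr_real// ger0_real.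
  have [|w Hw] := @complex_sandwich _ _ 0 h d.
    move=> f g; rewrite rmorphD/= !dE -linearB (le_trans (hC _))// -mulrDr.
    rewrite ler_wpM2l// linearB addrC (distrC x) (le_trans _ (ler_normD _ _))//.
    by rewrite addrC addrA subrK.
  by exists w => f; rewrite (le_trans (Hw f))// rmorphMn/= dE mulrnAl.
have [psi psiP] := choice near_h.
have psi_linear : linear (psi : X -> R[i]^o).
  move=> a x y; apply/eqP; rewrite -subr_eq0 -normr_le0.
  apply/ler_addgt0Pr => e e0; rewrite add0r.
  (* At distance [d] from [iota f] and [iota g], the defect of linearity is at
     most [4 C (|a| + 1) d]; adding [1] makes the divisor [K] nonzero. *)
  pose K := (C *+ 2) * (`|a| + 1) *+ 2 + 1.
  have K0 : 0 < K by rewrite ltr_wpDl// mulrn_wge0// mulr_ge0 ?addr_ge0// mulrn_wge0.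
  have [f fx] := @dense_range_norm x (e / K) (divr_gt0 e0 K0).
  have [g gy] := @dense_range_norm y (e / K) (divr_gt0 e0 K0).
  have -> : psi (a *: x + y) - (a *: psi x + psi y) =
      (psi (a *: x + y) - h (a *: f + g)) -
      (a * (psi x - h f) + (psi y - h g)).
    have -> : h (a *: f + g) = a * h f + h g by exact: linearP.
    by rewrite mulrBr addrACA -opprD opprB addrA subrK.
  have axy : `|a *: x + y - iota (a *: f + g)| <=
      `|a| * `|x - iota f| + `|y - iota g|.
    rewrite linearP opprD addrACA -scalerBr -normrZ; exact: ler_normD.
  rewrite (le_trans (ler_normB _ _))//.
  rewrite (le_trans (lerD (psiP _ _) (ler_normD _ _)))// normrM.
  have D0 : 0 <= C *+ 2 by rewrite mulrn_wge0.
  have psix : `|a| * `|psi x - h f| <= C *+ 2 * (`|a| * `|x - iota f|).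
    by rewrite mulrCA ler_wpM2l.
  rewrite (le_trans (lerD (ler_wpM2l D0 axy) (lerD psix (psiP y g))))//.
  rewrite -!mulrDr -mulr2n.
  have fgK : `|a| * `|x - iota f| + `|y - iota g| <= (`|a| + 1) * (e / K).
    by rewrite mulrDl mul1r lerD ?ler_wpM2l ?(ltW fx) ?(ltW gy).
  have fgK2 : (`|a| * `|x - iota f| + `|y - iota g|) *+ 2 <=
      (`|a| + 1) * (e / K) *+ 2 by rewrite lerMn2r.
  rewrite (le_trans (ler_wpM2l D0 fgK2))//.
  rewrite mulrnAr mulrA -mulrnAl mulrCA ler_piMr ?(ltW e0)//.
  by rewrite ler_pdivrMr// mul1r /K lerDl.
pose P := GRing.isLinear.Build _ _ _ _ _ psi_linear.
pose Psi : {linear X -> R[i]^o} := HB.pack (psi : X -> R[i]^o) P.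
exists Psi; split.
  apply/linear_boundedP; near=> r => x.
  have h0 : h 0 = 0 :> R[i] by exact: linear0.
  have := psiP x 0; rewrite h0 linear0 !subr0 => /le_trans; apply.
  by rewrite ler_wpM2r//; near: r; apply: nbhs_pinfty_ge; rewrite ger0_real// mulrn_wge0.
move=> f; apply/eqP; rewrite -subr_eq0 -normr_le0.
by have := psiP (iota f) f; rewrite subrr normr0 mulr0.
Unshelve. all: by end_near.
Qed.

End DenseRange.

Section OperatorNorm.
Variables (R : realType) (V W : normedModType R[i]) (T : {linear V -> W}).

Lemma opnorm_le (C : R) : 0 <= C ->
  (forall x, `|T x| <= C%:C * `|x|) -> opnorm T <= C.
Proof.
move=> C0 TC; apply: ge_sup.
  by exists (complex.Re `|T 0|), 0 => //=; rewrite normr0 ler01.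
move=> _ [x /= x1 <-]; rewrite -lecR Re_norm (le_trans (TC x))//.
by rewrite ler_piMr// ler0c.
Qed.

(** Boundedness makes the set defining [opnorm T] bounded above, so that its
supremum is a genuine one; the bound then follows by normalizing [x]. *)
Lemma opnormP : bounded_near T (nbhs (0 : V)) ->
  forall x, `|T x| <= (opnorm T)%:C * `|x|.
Proof.
move=> /linear_boundedP/pinfty_ex_gt0[M M0 TM] x.
have [->|x0] := eqVneq x 0; first by rewrite linear0 !normr0 mulr0.
rewrite -ler_pdivrMr ?normr_gt0//.
have -> : `|T x| / `|x| = `|T (`|x|^-1 *: x)|.
  by rewrite linearZ normrZ ger0_norm ?invr_ge0// mulrC.
rewrite -Re_norm lecR; apply: ub_le_sup; last first.
  by exists (`|x|^-1 *: x) => //=; rewrite normrZ ger0_norm ?invr_ge0// mulVf ?normr_eq0.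
exists (complex.Re M) => _ [y /= y1 <-]; apply: le_Re.
by rewrite (le_trans (TM y))// ler_piMr// ltW.
Qed.

End OperatorNorm.

Section HilbertPoint.
Variables (R : realType) (H : hilbertSpace R) (X : completeNormedModType R[i]).
Variables (iota : {linear H -> X}) (phi : H).

(** The vector [(|phi|^2 / <f, phi>) f] differs from [phi] by a vector orthogonal
to [phi], so that its norm in [X] is at least that of [phi]. *)
Lemma hilbert_point_bound : hilbert_point iota phi ->
  forall f, `|inner H f phi| * `|iota phi| <= `|phi| ^+ 2 * `|iota f|.
Proof.
move=> [_ hp] f; set a := inner H f phi.
have [->|a0] := eqVneq a 0; first by rewrite normr0 mul0r mulr_ge0 ?exprn_ge0.
have := hp (a^-1 * `|phi| ^+ 2 *: f - phi).
rewrite linearBl/= linearZl_LR/= -/a inner_norm mulrAC mulVf// mul1r subrr.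
move=> /(_ erefl); rewrite addrC subrK linearZ normrZ normrM normfV.
rewrite [`|_ ^+ 2|]ger0_norm ?exprn_ge0// -mulrA.
by rewrite ler_pdivlMl ?normr_gt0.
Qed.

(** [xget] selects the norm of some bounded extension; the estimates of the main
proof hold for every such extension. *)
Lemma dual_normP : in_dual iota phi ->
  exists2 Psi, dual_extension iota phi Psi & dual_norm iota phi = opnorm Psi.
Proof.
move=> [Psi0 PsiE]; rewrite /dual_norm.
have [|Psi PsiP <-] := @xgetPex _ 0 [set opnorm Psi | Psi in dual_extension iota phi].
  by exists (opnorm Psi0), Psi0.
by exists Psi.
Qed.

End HilbertPoint.

Theorem theorem2 (R : realType) (H : hilbertSpace R)
    (X : completeNormedModType R[i]) (iota : {linear H -> X})
    (adm : admissible_pair iota) (phi : H) (phi_neq0 : phi != 0) :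
  hilbert_point iota phi <->
  in_dual iota phi /\
  `|iota phi| * (dual_norm iota phi)%:C = `|phi| ^+ 2.
Proof.
have [iota_inj iota_dense _ _] := adm.
have iphi0 : 0 < `|iota phi|.
  by rewrite normr_gt0 -(linear0 iota) (inj_eq iota_inj).
split=> [hp|[phi_dual norm_eq]].
  pose C := `|phi| ^+ 2 / `|iota phi|.
  have C0 : 0 <= C by rewrite divr_ge0 ?exprn_ge0.
  have hC f : `|inner H f phi| <= C * `|iota f|.
    by rewrite mulrAC ler_pdivlMr// hilbert_point_bound.
  have phi_dual : in_dual iota phi.
    exact: (@extend_functional _ _ _ _ iota_dense (applyr (inner H) phi) C).
  split=> //; have [Psi [Psi_bnd PsiE] ->] := dual_normP phi_dual.
  suff -> : (opnorm Psi)%:C = C by rewrite mulrC divfK// gt_eqF.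
  have CE : (complex.Re C)%:C = C by rewrite RRe_real// ger0_real.
  apply/eqP; rewrite eq_le; apply/andP; split.
    rewrite -CE lecR opnorm_le// ?CE//; first by rewrite -ler0c CE.
    apply: (@bounded_on_dense_range _ _ _ _ iota_dense) => // f.
    by rewrite PsiE.
  rewrite ler_pdivrMr//; have := opnormP Psi_bnd (iota phi).
  by rewrite PsiE inner_norm ger0_norm// exprn_ge0.
split=> // f f_phi.
have [Psi [Psi_bnd PsiE] normE] := dual_normP phi_dual.
have := opnormP Psi_bnd (iota (phi + f)).
rewrite PsiE linearDl/= inner_norm f_phi addr0 ger0_norm ?exprn_ge0//.
rewrite -norm_eq normE mulrC ler_pM2l//.
by rewrite -(pmulr_rgt0 _ iphi0) -normE norm_eq exprn_gt0 ?normr_gt0.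
Qed.
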